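(* Let $\varphi$ be a first-order sentence over a signature $\tau$. Then $\varphi$ is logically equivalent (over all $\tau$-structures) to a finite set of generalized dependencies over $\tau$ if and only if $\varphi$ is preserved under globally-homomorphic preimages, i.e. for all $\tau$-structures $\mathcal{A},\mathcal{B}$, if $\mathcal{A}\Rightarrow\mathcal{B}$ and $\mathcal{B}\models\varphi$ then $\mathcal{A}\models\varphi$.
   Context: Signatures are relational: a set of constant symbols and relation symbols with arities; structures have nonempty domains. Atomic formulas include equalities and relational atoms. A generalized dependency (GD) is a sentence $\forall\vec{x}(\phi(\vec{x})\rightarrow\exists\vec{y}(\psi_1\vee\cdots\vee\psi_n))$ with $n\ge 0$ and $\phi,\psi_i$ conjunctions of atomic formulas (for $n=0$ the head is $\bot$). For $a_1,\dots,a_k\in A$, $(\mathcal{A},a_1,\dots,a_k)$ is the expansion of $\mathcal{A}$ interpreting fresh constant symbols as $a_1,\dots,a_k$. A homomorphism preserves constants and relations; $\mathcal{A}\rightleftarrows\mathcal{B}$ means homomorphisms exist in both directions. $\mathcal{A}\Rightarrow\mathcal{B}$ means there is a function $\pi$ mapping every finite tuple $\vec a$ over $A$ to a tuple $\pi(\vec a)$ over $B$ of the same length with $(\mathcal{A},\vec{a})\rightleftarrows(\mathcal{B},\pi(\vec{a}))$. *)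

(* Defs.v *)
From Stdlib Require Import List.
Import ListNotations.
Set Implicit Arguments.

Record signature := Sig {
  sconst : Type;
  srel : Type;
  sarity : srel -> nat
}.

Definition idx (n : nat) := {i : nat | i < n}.

Section FO.
Variable sg : signature.

Record structure := Struct {
  dom : Type;
  dom_elt : dom;
  cst : sconst sg -> dom;
  rel : forall r : srel sg, (idx (sarity sg r) -> dom) -> Prop
}.

Inductive term := TVar (x : nat) | TCst (c : sconst sg).

Inductive formula :=
| FTrue | FFalse
| FEq (t1 t2 : term)
| FRel (r : srel sg) (ts : idx (sarity sg r) -> term)
| FNot (f : formula)
| FAnd (f g : formula) | FOr (f g : formula) | FImp (f g : formula)
| FAll (x : nat) (f : formula) | FEx (x : nat) (f : formula).

Definition term_free (x : nat) (t : term) : Prop :=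
  match t with TVar y => y = x | TCst _ => False end.

Fixpoint free_in (x : nat) (f : formula) : Prop :=
  match f with
  | FTrue | FFalse => False
  | FEq t1 t2 => term_free x t1 \/ term_free x t2
  | FRel r ts => exists i, term_free x (ts i)
  | FNot g => free_in x g
  | FAnd g h | FOr g h | FImp g h => free_in x g \/ free_in x h
  | FAll y g | FEx y g => y <> x /\ free_in x g
  end.

Definition sentence (f : formula) : Prop := forall x, ~ free_in x f.

Definition upd {A : Type} (v : nat -> A) (x : nat) (a : A) : nat -> A :=
  fun y => if Nat.eqb y x then a else v y.

Definition teval (M : structure) (v : nat -> dom M) (t : term) : dom M :=
  match t with TVar x => v x | TCst c => cst M c end.

Fixpoint eval (M : structure) (v : nat -> dom M) (f : formula) : Prop :=
  match f with
  | FTrue => True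
  | FFalse => False
  | FEq t1 t2 => teval M v t1 = teval M v t2
  | FRel r ts => rel M r (fun i => teval M v (ts i))
  | FNot g => ~ eval M v g
  | FAnd g h => eval M v g /\ eval M v h
  | FOr g h => eval M v g \/ eval M v h
  | FImp g h => eval M v g -> eval M v h
  | FAll x g => forall a : dom M, eval M (upd v x a) g
  | FEx x g => exists a : dom M, eval M (upd v x a) g
  end.

(* M |= f (for a sentence, independent of the valuation) *)
Definition models (M : structure) (f : formula) : Prop :=
  forall v : nat -> dom M, eval M v f.

Inductive atom :=
| AEq (t1 t2 : term)
| ARel (r : srel sg) (ts : idx (sarity sg r) -> term).

Definition atom_formula (a : atom) : formula :=
  match a with AEq t1 t2 => FEq t1 t2 | ARel r ts => FRel r ts end.

Definition conj (l : list atom) : formula :=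
  fold_right (fun a f => FAnd (atom_formula a) f) FTrue l.

Definition disj (l : list formula) : formula :=
  fold_right FOr FFalse l.

Definition foralls (xs : list nat) (f : formula) : formula :=
  fold_right FAll f xs.
Definition existss (ys : list nat) (f : formula) : formula :=
  fold_right FEx f ys.

Record gd := GD {
  gd_x : list nat;
  gd_body : list atom;
  gd_y : list nat;
  gd_heads : list (list atom)
}.

Definition gd_formula (g : gd) : formula :=
  foralls (gd_x g)
    (FImp (conj (gd_body g)) (existss (gd_y g) (disj (map conj (gd_heads g))))).

Definition is_gd_sentence (g : gd) : Prop := sentence (gd_formula g).

Definition hom (A B : structure) (h : dom A -> dom B) : Prop :=
  (forall c, h (cst A c) = cst B c) /\
  (forall r (t : idx (sarity sg r) -> dom A), rel A r t -> rel B r (fun i => h (t i))).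

(* homomorphism between expansions (A, as) -> (B, bs) *)
Definition hom_exp (A B : structure) (as_ : list (dom A)) (bs : list (dom B)) : Prop :=
  exists h, hom A B h /\ map h as_ = bs.

Definition homeq_exp (A B : structure) (as_ : list (dom A)) (bs : list (dom B)) : Prop :=
  hom_exp A B as_ bs /\ hom_exp B A bs as_.

Definition glob_hom (A B : structure) : Prop :=
  exists pi : list (dom A) -> list (dom B),
    forall as_ : list (dom A),
      length (pi as_) = length as_ /\ homeq_exp A B as_ (pi as_).

End FO.

Arguments TVar {sg}.
Arguments TCst {sg}.

(* Main.v *)
(* Easy direction: given values for the universal variables, push them into B along a
   homomorphism, find witnesses there, and pull these back along a homomorphism that
   returns the chosen values to themselves.

   Hard direction: let A satisfy all dependencies implied by phi.  By compactness A
   has an immersion f (a map preserving and reflecting primitive positive formulas)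
   into some B |= phi: an inconsistency of the diagram with phi would be a dependency
   implied by phi and refuted in A.  Put A_0 = A, B_0 = B and let A_(n+1), B_(n+1) be
   the ultrapowers of A_n, B_n by an ultrafilter depending only on the atomic diagram
   of B_n.  Then f extends to immersions A_n -> B_n; since f is an immersion there is a
   homomorphism B_n -> A_(n+1) undoing f on A_n, and it extends to
   B_(n+1) -> A_(n+2), and so on.  In the limits, f and these homomorphisms, one for
   each stage n, witness lim A_n => lim B_n.  Both limits are elementary extensions,
   so preservation gives A |= phi.  Compactness then yields finitely many
   dependencies. *)
Require Import Defs.
From Stdlib Require Import List.
From Stdlib Require Import Arith Lia ClassicalEpsilon FunctionalExtensionality PropExtensionality.
From mathcomp.classical Require filter.
Import ListNotations.
Set Implicit Arguments.

(** * Filters and ultrafilters *)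

Lemma idx_finite (n : nat) : exists l : list (idx n), forall k, In k l.
Proof.
induction n as [|n [l Hl]].
- exists []; intros [i Hi]; lia.
- exists (exist (fun i => i < S n) n (Nat.lt_succ_diag_r n) ::
          map (fun k : idx n => exist (fun i => i < S n) (proj1_sig k)
                 (Nat.lt_lt_succ_r _ _ (proj2_sig k))) l).
  intros [i Hi]; destruct (Nat.eq_dec i n) as [->|Hne]; [left|right].
  + f_equal; apply proof_irrelevance.
  + assert (Hi' : i < n) by lia; apply in_map_iff.
    exists (exist (fun i => i < n) i Hi'); split; [|apply Hl].
    f_equal; apply proof_irrelevance.
Qed.

Definition idx_list (n : nat) : list (idx n) :=
  proj1_sig (constructive_indefinite_description _ (idx_finite n)).

Lemma in_idx_list (n : nat) (k : idx n) : In k (idx_list n).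
Proof. unfold idx_list; destruct (constructive_indefinite_description _ _); auto. Qed.

Record is_filter (I : Type) (F : (I -> Prop) -> Prop) : Prop := {
  filter_all : forall P : I -> Prop, (forall i, P i) -> F P;
  filter_and : forall P Q : I -> Prop, F P -> F Q -> F (fun i => P i /\ Q i);
  filter_mono : forall P Q : I -> Prop, F P -> (forall i, P i -> Q i) -> F Q;
  filter_ex : forall P : I -> Prop, F P -> exists i, P i
}.

Section Filters.
Variables (I : Type) (F : (I -> Prop) -> Prop).
Hypothesis HF : is_filter F.

Lemma filter_mono2 (P Q S : I -> Prop) :
  F P -> F Q -> (forall i, P i -> Q i -> S i) -> F S.
Proof.
intros HP HQ H; apply (filter_mono HF _ _ (filter_and HF _ _ HP HQ)).
intros i [? ?]; auto.
Qed.
Arguments filter_mono2 {P Q S}.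

Lemma filter_Forall (T : Type) (l : list T) (P : T -> I -> Prop) :
  (forall t, In t l -> F (P t)) -> F (fun i => forall t, In t l -> P t i).
Proof.
induction l as [|t l IH]; intros H.
- apply (filter_all HF); intros i t [].
- assert (H1 : F (P t)) by (apply H; left; auto).
  assert (H2 : F (fun i => forall t, In t l -> P t i))
    by (apply IH; intros; apply H; right; auto).
  apply (filter_mono2 H1 H2); intros i ? ? t' [<-|]; auto.
Qed.

Lemma filter_idx (n : nat) (P : idx n -> I -> Prop) :
  (forall k, F (P k)) -> F (fun i => forall k, P k i).
Proof.
intros H.
apply (filter_mono HF _ _ (filter_Forall (idx_list n) P (fun k _ => H k))).
intros i Hi k; apply Hi, in_idx_list.
Qed.

Lemma filter_iff (P Q : I -> Prop) :
  F (fun i => P i <-> Q i) -> (F P <-> F Q).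
Proof. intros H; split; intros HP; apply (filter_mono2 H HP); tauto. Qed.

Lemma filter_const (P : Prop) : F (fun _ => P) <-> P.
Proof.
split; intros H.
- destruct (filter_ex HF _ H); auto.
- apply (filter_all HF); auto.
Qed.

End Filters.
Arguments filter_mono2 {I F} HF {P Q S}.

(** The index set of every compactness argument below: an index is a finite list of requirements,
    and almost every index contains any given one. The sets of lists including a fixed list generate
    a proper filter, as appending two lists serves both, and an ultrafilter extends it. *)
Lemma list_ultrafilter_exists (T : Type) :
  exists U : (list T -> Prop) -> Prop,
    is_filter U /\ (forall t, U (In t)) /\ (forall P, U P \/ U (fun i => ~ P i)).
Proof.
set (F := fun P : list T -> Prop => exists l, forall i, incl l i -> P i).
assert (HF : filter.ProperFilter F).
{ constructor.
  - intros [l Hl]; exact (Hl l (incl_refl l)).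
  - constructor.
    + exists []; intros; exact Logic.I.
    + intros P Q [l Hl] [m Hm]; exists (l ++ m); intros i Hi; split.
      * apply Hl; intros x Hx; apply Hi, in_or_app; auto.
      * apply Hm; intros x Hx; apply Hi, in_or_app; auto.
    + intros P Q HPQ [l Hl]; exists l; intros i Hi; apply HPQ, Hl, Hi. }
destruct (filter.ultraFilterLemma HF) as [U [HU HFU]].
pose proof (@filter.ultra_proper _ _ HU) as HP.
pose proof (@filter.filter_filter _ _ HP) as HPF.
exists U; split; [|split].
- constructor.
  + intros P H; exact (@filter.filterS _ _ HPF _ _ (fun i _ => H i) (@filter.filterT _ _ HPF)).
  + intros P Q H1 H2; exact (@filter.filterI _ _ HPF _ _ H1 H2).
  + intros P Q H1 H2; exact (@filter.filterS _ _ HPF _ _ H2 H1).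
  + intros P H; destruct (classic (exists i, P i)) as [|Hn]; auto.
    exfalso; apply (@filter.filter_not_empty _ _ HP).
    refine (@filter.filterS _ _ HPF P _ _ H).
    intros i Hi; apply Hn; exists i; exact Hi.
- intros t; apply HFU; exists [t]; intros i Hi; apply Hi; left; auto.
- intros P; exact (@filter.in_ultra_setVsetC _ _ P HU).
Qed.

(** Fixing one ultrafilter per type makes ultrapowers functions of the exponent [T], so that
    different structures can be raised to the same power. *)
Definition UL (T : Type) : (list T -> Prop) -> Prop :=
  proj1_sig (constructive_indefinite_description _ (@list_ultrafilter_exists T)).
Arguments UL : clear implicits.

Lemma UL_filter (T : Type) : is_filter (UL T).
Proof. unfold UL; destruct (constructive_indefinite_description _ _) as [U HU]; apply HU. Qed.

Lemma UL_in (T : Type) (t : T) : UL T (In t).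
Proof. unfold UL; destruct (constructive_indefinite_description _ _) as [U HU]; apply HU. Qed.

Lemma UL_dec (T : Type) (P : list T -> Prop) : UL T P \/ UL T (fun i => ~ P i).
Proof. unfold UL; destruct (constructive_indefinite_description _ _) as [U HU]; apply HU. Qed.

(** * Free variables and valuations *)

Section Logic.
Variable sg : signature.

Lemma teval_ext (M : structure sg) (v w : nat -> dom M) (t : term sg) :
  (forall x, term_free x t -> v x = w x) -> teval M v t = teval M w t.
Proof. destruct t; simpl; auto. Qed.

Lemma eval_ext (M : structure sg) (f : formula sg) :
  forall v w : nat -> dom M,
  (forall x, free_in x f -> v x = w x) -> (eval M v f <-> eval M w f).
Proof.
induction f; intros v w H; simpl in *; try tauto.
- rewrite (teval_ext M v w t1), (teval_ext M v w t2); auto; tauto.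
- replace (fun i => teval M v (ts i)) with (fun i => teval M w (ts i)); [tauto|].
  extensionality i; symmetry; apply teval_ext; eauto.
- rewrite (IHf v w); auto; tauto.
- rewrite (IHf1 v w), (IHf2 v w); auto; tauto.
- rewrite (IHf1 v w), (IHf2 v w); auto; tauto.
- rewrite (IHf1 v w), (IHf2 v w); auto; tauto.
- assert (E : forall a, eval M (upd v x a) f <-> eval M (upd w x a) f).
  { intros a; apply IHf; intros y Hy; unfold upd.
    destruct (Nat.eqb_spec y x); auto. }
  split; intros Ha a; apply E; auto.
- assert (E : forall a, eval M (upd v x a) f <-> eval M (upd w x a) f).
  { intros a; apply IHf; intros y Hy; unfold upd.
    destruct (Nat.eqb_spec y x); auto. }
  split; intros [a Ha]; exists a; apply E; auto.
Qed.

Lemma sentence_eval (M : structure sg) (f : formula sg) (v w : nat -> dom M) :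
  sentence f -> (eval M v f <-> eval M w f).
Proof. intros H; apply eval_ext; intros x Hx; destruct (H x Hx). Qed.

(** A filter is closed under finite intersections only; with finitely many free variables, agreement
    at each of them holds simultaneously on a large set. *)
Lemma free_bound (f : formula sg) : exists m, forall x, free_in x f -> x < m.
Proof.
assert (T : forall t : term sg, exists m, forall x, term_free x t -> x < m).
{ intros [y|c]; [exists (S y)|exists 0]; simpl; intros; subst; lia || tauto. }
induction f; simpl; try (exists 0; tauto); try assumption.
- destruct (T t1) as [m1 H1], (T t2) as [m2 H2]; exists (m1 + m2).
  intros x [H|H]; [apply H1 in H|apply H2 in H]; lia.
- assert (H : forall l : list (idx (sarity sg r)),
             exists m, forall i x, In i l -> term_free x (ts i) -> x < m).
  { induction l as [|i l [m IH]]; [exists 0; simpl; tauto|].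
    destruct (T (ts i)) as [m' H']; exists (m + m'); intros j x [<-|Hj] Hx.
    - apply H' in Hx; lia.
    - specialize (IH j x Hj Hx); lia. }
  destruct (H (idx_list _)) as [m Hm]; exists m; intros x [i Hi].
  apply (Hm i x); auto; apply in_idx_list.
- destruct IHf1 as [m1 H1], IHf2 as [m2 H2]; exists (m1 + m2).
  intros x [H|H]; [apply H1 in H|apply H2 in H]; lia.
- destruct IHf1 as [m1 H1], IHf2 as [m2 H2]; exists (m1 + m2).
  intros x [H|H]; [apply H1 in H|apply H2 in H]; lia.
- destruct IHf1 as [m1 H1], IHf2 as [m2 H2]; exists (m1 + m2).
  intros x [H|H]; [apply H1 in H|apply H2 in H]; lia.
- destruct IHf as [m H]; exists m; intros y [_ Hy]; auto.
- destruct IHf as [m H]; exists m; intros y [_ Hy]; auto.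
Qed.

Lemma filter_free (I : Type) (F : (I -> Prop) -> Prop) (f : formula sg)
    (P : nat -> I -> Prop) :
  is_filter F -> (forall x, F (P x)) -> F (fun i => forall x, free_in x f -> P x i).
Proof.
intros HF H; destruct (free_bound f) as [m Hm].
apply (filter_mono HF _ _ (filter_Forall HF (seq 0 m) P (fun x _ => H x))).
intros i Hi x Hx; apply Hi, in_seq; specialize (Hm x Hx); lia.
Qed.

Lemma filter_eval_ext (I : Type) (F : (I -> Prop) -> Prop) (M : I -> structure sg)
    (f : formula sg) (v w : forall i, nat -> dom (M i)) :
  is_filter F -> (forall x, F (fun i => v i x = w i x)) ->
  F (fun i => eval (M i) (v i) f) <-> F (fun i => eval (M i) (w i) f).
Proof.
intros HF H; apply (filter_iff HF).
apply (filter_mono HF _ _ (filter_free f _ HF H)).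
intros i Hi; apply eval_ext, Hi.
Qed.

(** * Reduced products *)

(* Reduced product of the structures [rM i] modulo the filter [rF], with elements
   restricted to the families satisfying [rX]: all families give ultraproducts,
   the eventually coherent families of a chain give its direct limit. *)
Record redprod := RedProd {
  rI : Type;
  rF : (rI -> Prop) -> Prop;
  r_filter : is_filter rF;
  rM : rI -> structure sg;
  rX : (forall i, dom (rM i)) -> Prop;
  r_elt : forall i, dom (rM i);
  r_eltX : rX r_elt;
  r_cstX : forall c, rX (fun i => cst (rM i) c)
}.

Section ReducedProduct.
Variable R : redprod.

(* The quotient modulo [rF] is realized by canonical representatives. *)
Definition canon (x : forall i, dom (rM R i)) : forall i, dom (rM R i) :=
  epsilon (inhabits (r_elt R)) (fun y => rX R y /\ rF R (fun i => x i = y i)).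

Lemma canon_spec (x : forall i, dom (rM R i)) :
  rX R x -> rX R (canon x) /\ rF R (fun i => x i = canon x i).
Proof.
intros H; unfold canon; apply epsilon_spec; exists x; split; auto.
apply (filter_all (r_filter R)); auto.
Qed.

(** Equivalent families define extensionally equal predicates, and [epsilon] makes the same choice
    for equal predicates. *)
Lemma canon_eq (x y : forall i, dom (rM R i)) :
  rF R (fun i => x i = y i) -> canon x = canon y.
Proof.
intros H; unfold canon; f_equal; extensionality z.
apply propositional_extensionality; split; intros [H1 H2]; split; auto;
  apply (filter_mono2 (r_filter R) H H2); intros; congruence.
Qed.

Definition rdom : Type := {x : forall i, dom (rM R i) | rX R x /\ canon x = x}.

Lemma canon_rdom (x : forall i, dom (rM R i)) (Hx : rX R x) :
  rX R (canon x) /\ canon (canon x) = canon x.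
Proof.
destruct (canon_spec x Hx) as [H1 H2]; split; auto.
symmetry; apply canon_eq; auto.
Qed.

Definition cls (x : forall i, dom (rM R i)) (Hx : rX R x) : rdom :=
  exist _ (canon x) (canon_rdom x Hx).

Definition Red : structure sg := {|
  dom := rdom;
  dom_elt := cls (r_elt R) (r_eltX R);
  cst := fun c => cls _ (r_cstX R c);
  rel := fun r t => rF R (fun i => rel (rM R i) r (fun k => proj1_sig (t k) i))
|}.

Definition rep (q : dom Red) : forall i, dom (rM R i) := proj1_sig q.

Lemma repX (q : dom Red) : rX R (rep q).
Proof. exact (proj1 (proj2_sig q)). Qed.

Lemma rep_cls (x : forall i, dom (rM R i)) (Hx : rX R x) :
  rF R (fun i => rep (cls x Hx) i = x i).
Proof.
apply (filter_mono (r_filter R) _ _ (proj2 (canon_spec x Hx))); auto.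
Qed.

Lemma rep_inj (p q : dom Red) : rF R (fun i => rep p i = rep q i) -> p = q.
Proof.
destruct p as [x [Hx Hx']], q as [y [Hy Hy']]; simpl; intros H.
apply canon_eq in H; assert (E : x = y) by congruence; subst y.
f_equal; apply proof_irrelevance.
Qed.

Lemma red_eq (p q : dom Red) : p = q <-> rF R (fun i => rep p i = rep q i).
Proof.
split; [intros ->; apply (filter_all (r_filter R)); auto|apply rep_inj].
Qed.

Lemma cls_eq (x : forall i, dom (rM R i)) (Hx : rX R x) (q : dom Red) :
  rF R (fun i => x i = rep q i) -> cls x Hx = q.
Proof.
intros H; apply rep_inj.
apply (filter_mono2 (r_filter R) H (rep_cls x Hx)); intros; congruence.
Qed.

Lemma rep_teval (v : nat -> dom Red) (t : term sg) :
  rF R (fun i => rep (teval Red v t) i = teval (rM R i) (fun x => rep (v x) i) t).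
Proof.
destruct t; [apply (filter_all (r_filter R)); auto|apply rep_cls].
Qed.

(** What the theorem of Łoś asks of the filter and of the admissible families. Ultraproducts supply
    [decided] and [witnessed] by maximality of the filter and by choice, chain limits by
    elementarity of the chain. *)
Hypothesis decided : forall (f : formula sg) (v : nat -> forall i, dom (rM R i)),
  (forall x, rX R (v x)) ->
  rF R (fun i => eval (rM R i) (fun x => v x i) f) \/
  rF R (fun i => ~ eval (rM R i) (fun x => v x i) f).
Hypothesis witnessed : forall (f : formula sg) (x : nat) (v : nat -> forall i, dom (rM R i)),
  (forall x, rX R (v x)) ->
  rF R (fun i => exists a, eval (rM R i) (upd (fun x => v x i) x a) f) ->
  exists y, rX R y /\ rF R (fun i => eval (rM R i) (upd (fun x => v x i) x (y i)) f).

Let HF := r_filter R.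

Lemma los_not (f : formula sg) (v : nat -> forall i, dom (rM R i)) :
  (forall x, rX R (v x)) ->
  rF R (fun i => ~ eval (rM R i) (fun x => v x i) f) <->
  ~ rF R (fun i => eval (rM R i) (fun x => v x i) f).
Proof.
intros Hv; split.
- intros H1 H2.
  assert (H : rF R (fun _ => False)) by (apply (filter_mono2 HF H1 H2); auto).
  exact (proj1 (filter_const HF _) H).
- intros H; destruct (decided f v Hv); tauto.
Qed.

Lemma los_upd (f : formula sg) (v : nat -> dom Red) (x : nat) (y : forall i, dom (rM R i))
    (a : dom Red) :
  rF R (fun i => rep a i = y i) ->
  rF R (fun i => eval (rM R i) (fun z => rep (upd v x a z) i) f) <->
  rF R (fun i => eval (rM R i) (upd (fun z => rep (v z) i) x (y i)) f).
Proof.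
intros H; apply (filter_eval_ext (rM R) f (fun i z => rep (upd v x a z) i)
                  (fun i => upd (fun z => rep (v z) i) x (y i)) HF).
intros z; unfold upd; destruct (Nat.eqb z x); auto.
apply (filter_all HF); auto.
Qed.

Lemma los (f : formula sg) : forall v : nat -> dom Red,
  eval Red v f <-> rF R (fun i => eval (rM R i) (fun x => rep (v x) i) f).
Proof.
induction f; intros v; simpl.
- rewrite (filter_const HF); tauto.
- rewrite (filter_const HF); tauto.
- rewrite red_eq; apply (filter_iff HF).
  apply (filter_mono2 HF (rep_teval v t1) (rep_teval v t2)).
  intros i -> ->; tauto.
- apply (filter_iff HF).
  assert (H := filter_idx HF _ (fun k => rep_teval v (ts k))).
  apply (filter_mono HF _ _ H); intros i Hi; simpl in Hi.
  match goal with |- rel _ _ ?a <-> rel _ _ ?b => replace b with a; [tauto|] end.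
  extensionality k; apply Hi.
- rewrite (los_not f (fun x => rep (v x)) (fun x => repX (v x))), IHf; tauto.
- rewrite IHf1, IHf2; split.
  + intros [H1 H2]; exact (filter_and HF _ _ H1 H2).
  + intros H; split; apply (filter_mono HF _ _ H); tauto.
- rewrite IHf1, IHf2; split.
  + intros [H|H]; apply (filter_mono HF _ _ H); tauto.
  + intros H; destruct (decided f1 (fun x => rep (v x)) (fun x => repX (v x))) as [H'|H'];
      [left; auto|right; apply (filter_mono2 HF H H'); tauto].
- rewrite IHf1, IHf2; split.
  + intros H; destruct (decided f1 (fun x => rep (v x)) (fun x => repX (v x))) as [H'|H'].
    * apply (filter_mono HF _ _ (H H')); tauto.
    * apply (filter_mono HF _ _ H'); tauto.
  + intros H H'; apply (filter_mono2 HF H H'); tauto.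
- split.
  + intros H.
    (* If the universal formula failed almost everywhere, [witnessed] for [FNot f] would gather the
       counterexamples into one admissible family, whose class contradicts [H]. *)
    destruct (decided (FAll x f) (fun x => rep (v x)) (fun x => repX (v x))) as [H'|H']; auto.
    exfalso.
    destruct (witnessed (FNot f) x (fun x => rep (v x)) (fun x => repX (v x))) as [y [Hy Hy']].
    { apply (filter_mono HF _ _ H'); simpl; intros i Hi.
      exact (not_all_ex_not _ _ Hi). }
    assert (E := proj1 (IHf _) (H (cls y Hy))).
    apply (los_upd f v x y (cls y Hy) (rep_cls y Hy)) in E.
    simpl in Hy'.
    assert (N : rF R (fun _ => False)) by (apply (filter_mono2 HF E Hy'); auto).
    exact (proj1 (filter_const HF _) N).
  + intros H a; apply IHf; apply (los_upd f v x (rep a) a).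
    * apply (filter_all HF); auto.
    * apply (filter_mono HF _ _ H); auto.
- split.
  + intros [a Ha]; apply IHf in Ha; apply (los_upd f v x (rep a) a) in Ha.
    * apply (filter_mono HF _ _ Ha); eauto.
    * apply (filter_all HF); auto.
  + intros H; destruct (witnessed f x (fun x => rep (v x)) (fun x => repX (v x)) H)
      as [y [Hy Hy']].
    exists (cls y Hy); apply IHf.
    apply (los_upd f v x y (cls y Hy) (rep_cls y Hy)); auto.
Qed.

End ReducedProduct.


Arguments rep {R}.
Arguments cls {R}.

(** * Ultrapowers and immersions *)

(* Atoms with variables in an arbitrary type, so that elements of a structure
   can be their own names. *)
Inductive patom (X : Type) :=
| PEq (t1 t2 : X + sconst sg)
| PRel (r : srel sg) (ts : idx (sarity sg r) -> X + sconst sg).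
Arguments PEq {X}.
Arguments PRel {X}.

Definition pterm (M : structure sg) (X : Type) (w : X -> dom M) (t : X + sconst sg) : dom M :=
  match t with inl x => w x | inr c => cst M c end.

Definition holds (M : structure sg) (X : Type) (w : X -> dom M) (p : patom X) : Prop :=
  match p with
  | PEq t1 t2 => pterm M w t1 = pterm M w t2
  | PRel r ts => rel M r (fun k => pterm M w (ts k))
  end.

Definition tmap (X Y : Type) (g : X -> Y) (t : X + sconst sg) : Y + sconst sg :=
  match t with inl x => inl (g x) | inr c => inr c end.

Definition pmap (X Y : Type) (g : X -> Y) (p : patom X) : patom Y :=
  match p with
  | PEq t1 t2 => PEq (tmap g t1) (tmap g t2)
  | PRel r ts => PRel r (fun k => tmap g (ts k))
  end.

Definition tvars (X : Type) (t : X + sconst sg) : list X :=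
  match t with inl x => [x] | inr _ => [] end.

Definition pvars (X : Type) (p : patom X) : list X :=
  match p with
  | PEq t1 t2 => tvars t1 ++ tvars t2
  | PRel r ts => flat_map (fun k => tvars (ts k)) (idx_list (sarity sg r))
  end.

Lemma holds_pmap (M : structure sg) (X Y : Type) (g : X -> Y) (w : Y -> dom M) (p : patom X) :
  holds M w (pmap g p) <-> holds M (fun x => w (g x)) p.
Proof.
assert (E : forall t, pterm M w (tmap g t) = pterm M (fun x => w (g x)) t)
  by (intros []; auto).
destruct p; simpl; [rewrite !E; tauto|].
replace (fun k => pterm M (fun x => w (g x)) (ts k))
  with (fun k => pterm M w (tmap g (ts k))); [tauto|].
extensionality k; auto.
Qed.

Lemma holds_ext (M : structure sg) (X : Type) (w w' : X -> dom M) (p : patom X) :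
  (forall x, In x (pvars p) -> w x = w' x) -> (holds M w p <-> holds M w' p).
Proof.
assert (E : forall t, (forall x, In x (tvars t) -> w x = w' x) -> pterm M w t = pterm M w' t)
  by (intros [] H; auto; apply H; left; auto).
destruct p; simpl; intros H.
- rewrite !E; [tauto| |]; intros; apply H, in_or_app; auto.
- replace (fun k => pterm M w' (ts k)) with (fun k => pterm M w (ts k)); [tauto|].
  extensionality k; apply E; intros x Hx; apply H, in_flat_map.
  exists k; split; auto; apply in_idx_list.
Qed.

Lemma holds_hom (A B : structure sg) (h : dom A -> dom B) (X : Type) (w : X -> dom A)
    (p : patom X) :
  hom A B h -> holds A w p -> holds B (fun x => h (w x)) p.
Proof.
intros [Hc Hr].
assert (E : forall t, h (pterm A w t) = pterm B (fun x => h (w x)) t)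
  by (intros []; simpl; auto).
destruct p; simpl; intros H.
- rewrite <- !E; congruence.
- apply Hr in H; replace (fun k => pterm B (fun x => h (w x)) (ts k))
    with (fun k => h (pterm A w (ts k))); auto.
  extensionality k; auto.
Qed.

(** Constants are covered too: the equation between [c] and the element naming its value is a true
    atom. *)
Lemma hom_of_facts (A B : structure sg) (h : dom A -> dom B) :
  (forall p, holds A (fun x => x) p -> holds B h p) -> hom A B h.
Proof.
intros H; split.
- intros c; exact (H (PEq (inl (cst A c)) (inr c)) eq_refl).
- intros r t Ht; exact (H (PRel r (fun k => inl (t k))) Ht).
Qed.

Lemma filter_holds_ext (I : Type) (F : (I -> Prop) -> Prop) (M : I -> structure sg)
    (X : Type) (p : patom X) (v w : forall i, X -> dom (M i)) :
  is_filter F -> (forall x, F (fun i => v i x = w i x)) ->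
  F (fun i => holds (M i) (v i) p) <-> F (fun i => holds (M i) (w i) p).
Proof.
intros HF H; apply (filter_iff HF).
apply (filter_mono HF _ _ (filter_Forall HF (pvars p) _ (fun x _ => H x))).
intros i Hi; apply holds_ext, Hi.
Qed.

Lemma holds_red (R : redprod) (X : Type) (w : X -> dom (Red R)) (p : patom X) :
  holds (Red R) w p <-> rF R (fun i => holds (rM R i) (fun x => rep (w x) i) p).
Proof.
pose proof (r_filter R) as HF.
assert (E : forall t, rF R (fun i => rep (pterm (Red R) w t) i =
                              pterm (rM R i) (fun x => rep (w x) i) t)).
{ intros [x|c]; simpl; [apply (filter_all HF); auto|apply (rep_cls R _ (r_cstX R c))]. }
destruct p; simpl.
- etransitivity; [apply red_eq|]; apply (filter_iff HF).
  apply (filter_mono2 HF (E t1) (E t2)); intros i -> ->; tauto.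
- apply (filter_iff HF).
  assert (H := filter_idx HF _ (fun k => E (ts k))).
  apply (filter_mono HF _ _ H); intros i Hi; simpl in Hi.
  match goal with |- rel _ _ ?a <-> rel _ _ ?b => replace b with a; [tauto|] end.
  extensionality k; apply Hi.
Qed.

(** [G] acts on whole families, which lets a map between limits shift the index by one. It is
    applied to chosen representatives, so the map on classes is well defined by construction. *)
Lemma red_hom (R R' : redprod) (G : (forall i, dom (rM R i)) -> forall j, dom (rM R' j))
    (GX : forall x, rX R x -> rX R' (G x)) :
  (forall p : patom (dom (Red R)),
     rF R (fun i => holds (rM R i) (fun q => rep q i) p) ->
     rF R' (fun j => holds (rM R' j) (fun q => G (rep q) j) p)) ->
  hom (Red R) (Red R') (fun q => cls (G (rep q)) (GX _ (repX q))).
Proof.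
intros H; apply hom_of_facts; intros p Hp; apply holds_red in Hp.
apply holds_red; apply H in Hp.
eapply (filter_holds_ext (rM R') p); [apply r_filter| |exact Hp].
intros q; apply rep_cls.
Qed.

Definition uprod_data (T : Type) (M : list T -> structure sg) : redprod := {|
  r_filter := UL_filter T;
  rM := M;
  rX := fun _ => True;
  r_elt := fun i => dom_elt (M i);
  r_eltX := Logic.I;
  r_cstX := fun _ => Logic.I
|}.

Definition uprod (T : Type) (M : list T -> structure sg) : structure sg := Red (uprod_data M).

Definition ucls (T : Type) (M : list T -> structure sg) (x : forall i, dom (M i)) :
  dom (uprod M) := @cls (uprod_data M) x Logic.I.

Lemma rep_ucls (T : Type) (M : list T -> structure sg) (x : forall i, dom (M i)) :
  UL T (fun i => rep (ucls M x) i = x i).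
Proof. exact (rep_cls (uprod_data M) x Logic.I). Qed.

Lemma ucls_eq (T : Type) (M : list T -> structure sg) (x : forall i, dom (M i))
    (q : dom (uprod M)) :
  UL T (fun i => x i = rep q i) -> ucls M x = q.
Proof. exact (@cls_eq (uprod_data M) x Logic.I q). Qed.
Arguments ucls_eq {T} M x q.

Lemma uprod_los (T : Type) (M : list T -> structure sg) (f : formula sg)
    (v : nat -> dom (uprod M)) :
  eval (uprod M) v f <-> UL T (fun i => eval (M i) (fun x => rep (v x) i) f).
Proof.
apply (@los (uprod_data M)).
- intros g w _; apply UL_dec.
- intros g x w _ H; simpl in *.
  exists (fun i => epsilon (inhabits (dom_elt (M i)))
            (fun a => eval (M i) (upd (fun z => w z i) x a) g)).
  split; auto; apply (filter_mono (UL_filter T) _ _ H).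
  intros i Hi; apply epsilon_spec; exact Hi.
Qed.

Lemma uprod_holds (T : Type) (M : list T -> structure sg) (X : Type) (p : patom X)
    (w : X -> dom (uprod M)) :
  holds (uprod M) w p <-> UL T (fun i => holds (M i) (fun x => rep (w x) i) p).
Proof. apply (@holds_red (uprod_data M)). Qed.

Lemma uprod_holds_ucls (T : Type) (M : list T -> structure sg) (X : Type) (p : patom X)
    (w : forall i, X -> dom (M i)) :
  holds (uprod M) (fun x => ucls M (fun i => w i x)) p <->
  UL T (fun i => holds (M i) (w i) p).
Proof.
rewrite uprod_holds; apply filter_holds_ext; [apply UL_filter|].
intros x; apply (rep_ucls M (fun i => w i x)).
Qed.

Definition upow (T : Type) (M : structure sg) : structure sg := uprod (fun _ : list T => M).

Definition diag (T : Type) (M : structure sg) (a : dom M) : dom (upow T M) :=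
  ucls (fun _ => M) (fun _ => a).

Definition umap (T : Type) (A B : structure sg) (f : dom A -> dom B) (q : dom (upow T A)) :
  dom (upow T B) := ucls (fun _ => B) (fun i => f (rep q i)).
Arguments umap {T} A B f q.

Lemma rep_diag (T : Type) (M : structure sg) (a : dom M) :
  UL T (fun i => rep (diag T M a) i = a).
Proof. apply (rep_ucls (fun _ => M)). Qed.
Arguments rep_diag : clear implicits.

Lemma diag_eval (T : Type) (M : structure sg) (f : formula sg) (v : nat -> dom M) :
  eval M v f <-> eval (upow T M) (fun x => diag T M (v x)) f.
Proof.
unfold upow; rewrite uprod_los.
rewrite (filter_eval_ext (fun _ => M) f (fun i x => rep (diag T M (v x)) i) (fun _ => v)
           (UL_filter T)).
- rewrite (filter_const (UL_filter T)); tauto.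
- intros x; apply rep_diag.
Qed.

Lemma umap_diag (T : Type) (A B : structure sg) (f : dom A -> dom B) (a : dom A) :
  umap A B f (diag T A a) = diag T B (f a).
Proof.
apply (ucls_eq (fun _ => B)).
apply (filter_mono2 (UL_filter T) (rep_diag T A a) (rep_diag T B (f a))).
intros; congruence.
Qed.

Lemma umap_hom (T : Type) (A B : structure sg) (f : dom A -> dom B) :
  hom A B f -> hom (upow T A) (upow T B) (umap A B f).
Proof.
intros Hf; apply hom_of_facts; intros p Hp; apply uprod_holds in Hp.
apply (uprod_holds_ucls (fun _ => B) p (fun i q => f (rep q i))).
apply (filter_mono (UL_filter T) _ _ Hp); intros i; apply holds_hom; auto.
Qed.

(* Local retractability: equivalently, [e] preserves and reflects primitive
   positive formulas with parameters. *)
Definition immersion (C D : structure sg) (e : dom C -> dom D) : Prop :=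
  hom C D e /\
  forall l : list (patom (dom D)), (forall p, In p l -> holds D (fun x => x) p) ->
  exists w : dom D -> dom C, (forall c, w (e c) = c) /\ forall p, In p l -> holds C w p.

(* The exponent depends on [D] only, so one ultrapower of [M] serves all [C] and [h]. *)
Lemma hom_extension (C D M : structure sg) (e : dom C -> dom D) (h : dom C -> dom M) :
  immersion C D e -> hom C M h ->
  exists h' : dom D -> dom (upow (patom (dom D)) M),
    hom D (upow (patom (dom D)) M) h' /\ forall c, h' (e c) = diag (patom (dom D)) M (h c).
Proof.
intros [_ He] Hh; set (T := patom (dom D)).
(* For each finite list, retract [D] to [C] respecting the listed atoms that are true in [D], then
   apply [h]. *)
assert (W : forall l : list T, exists w : dom D -> dom M, (forall c, w (e c) = h c) /\
              forall p, In p l -> holds D (fun x => x) p -> holds M w p).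
{ intros l.
  set (b := fun p => if excluded_middle_informative (holds D (fun x => x) p)
                     then true else false).
  assert (Hb : forall p, b p = true <-> holds D (fun x => x) p).
  { intros p; unfold b; destruct excluded_middle_informative; split; auto; discriminate. }
  destruct (He (filter b l)) as [w [Hw1 Hw2]].
  { intros p Hp; apply filter_In in Hp; apply Hb; tauto. }
  exists (fun d => h (w d)); split; [intros; congruence|].
  intros p Hp1 Hp2; apply holds_hom; auto; apply Hw2, filter_In; split; auto; apply Hb; auto. }
apply choice in W; destruct W as [w Hw].
(* A true atom belongs to almost every list, hence survives. The local maps agree with [h] on the
   image of [e] at every index, which gives the diagonal values. *)
exists (fun d => ucls (fun _ => M) (fun i => w i d)); split.
- apply hom_of_facts; intros p Hp; apply (uprod_holds_ucls (fun _ => M)).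
  apply (filter_mono (UL_filter T) _ _ (UL_in p)).
  intros i Hi; apply Hw; auto.
- intros c; unfold diag; f_equal; extensionality i; apply Hw.
Qed.

(** Finitely many atoms true in the ultrapower hold together at some coordinate; evaluating
    representatives there is, up to a correction, the required retraction. *)
Lemma diag_immersion (T : Type) (M : structure sg) : immersion M (upow T M) (diag T M).
Proof.
split.
- apply hom_of_facts; intros p Hp; apply (uprod_holds_ucls (fun _ => M) p (fun _ x => x)).
  apply (filter_const (UL_filter T)); auto.
- intros l Hl.
  assert (inj : forall c c', diag T M c = diag T M c' -> c = c').
  { intros c c' E.
    assert (H : UL T (fun _ => c = c')).
    { pose proof (rep_diag T M c) as H; rewrite E in H.
      apply (filter_mono2 (UL_filter T) H (rep_diag T M c')); intros; congruence. }
    exact (proj1 (filter_const (UL_filter T) _) H). }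
  (* [rep d i] is corrected on the image of [diag], where it agrees with the
     required value only for almost all [i]. *)
  set (w := fun (i : list T) (d : dom (upow T M)) =>
         match excluded_middle_informative (exists c, d = diag T M c) with
         | left _ => epsilon (inhabits (rep d i)) (fun a => forall c, d = diag T M c -> a = c)
         | right _ => rep d i
         end).
  assert (Hw : forall i c, w i (diag T M c) = c).
  { intros i c; unfold w; destruct excluded_middle_informative as [_|N].
    - match goal with |- epsilon ?a ?P = _ => assert (H : P (epsilon a P)) end.
      { apply epsilon_spec; exists c; intros c' E; auto. }
      apply H; auto.
    - destruct N; eauto. }
  assert (Hl' : UL T (fun i => forall p, In p l -> holds M (w i) p)).
  { apply (filter_Forall (UL_filter T)); intros p Hp.
    specialize (Hl p Hp); apply uprod_holds in Hl.
    refine (proj1 (filter_holds_ext (fun _ => M) p (fun i d => rep d i) w (UL_filter T) _) Hl).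
    intros d; destruct (classic (exists c, d = diag T M c)) as [[c ->]|N].
    - apply (filter_mono (UL_filter T) _ _ (rep_diag T M c)).
      intros i ->; symmetry; apply Hw.
    - apply (filter_all (UL_filter T)); intros i; unfold w.
      destruct excluded_middle_informative; tauto. }
  destruct (filter_ex (UL_filter T) _ Hl') as [i Hi]; exists (w i); split; [apply Hw|exact Hi].
Qed.

(** The retraction is assembled coordinatewise: at [i], the atoms of [l] are read in [B] through the
    [i]-th representatives and retracted to [A]. *)
Lemma umap_immersion (T : Type) (A B : structure sg) (f : dom A -> dom B) :
  immersion A B f -> immersion (upow T A) (upow T B) (umap A B f).
Proof.
intros [Hh Hf]; split; [apply umap_hom; auto|]; intros l Hl.
assert (W : forall i : list T, exists w : dom B -> dom A, (forall c, w (f c) = c) /\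
   ((forall p, In p l -> holds B (fun q : dom (upow T B) => rep q i) p) ->
    forall p, In p l -> holds A (fun q : dom (upow T B) => w (rep q i)) p)).
{ intros i.
  destruct (classic (forall p, In p l -> holds B (fun q : dom (upow T B) => rep q i) p))
    as [H|H].
  - destruct (Hf (map (pmap (fun q : dom (upow T B) => rep q i)) l)) as [w [Hw1 Hw2]].
    { intros p Hp; apply in_map_iff in Hp; destruct Hp as [p' [<- Hp]].
      apply holds_pmap, H; auto. }
    exists w; split; auto; intros _ p Hp.
    apply (holds_pmap A (fun q : dom (upow T B) => rep q i)), Hw2, in_map; auto.
  (* At these negligible indices any map undoing [f] will do; the empty list of atoms provides
     one. *)
  - destruct (Hf []) as [w [Hw1 _]]; [intros p []|].
    exists w; split; auto; tauto. }
apply choice in W; destruct W as [w Hw].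
exists (fun q : dom (upow T B) => ucls (fun _ => A) (fun i => w i (rep q i))); split.
- intros c; apply (ucls_eq (fun _ => A)).
  apply (filter_mono (UL_filter T) _ _ (rep_ucls (fun _ => B) (fun i => f (rep c i)))).
  intros i Hi; change (rep (umap A B f c) i = f (rep c i)) in Hi.
  rewrite Hi; apply Hw.
- intros p Hp; apply (uprod_holds_ucls (fun _ => A) p (fun i (q : dom (upow T B)) => w i (rep q i))).
  assert (H : UL T (fun i => forall p, In p l -> holds B (fun q : dom (upow T B) => rep q i) p)).
  { apply (filter_Forall (UL_filter T)); intros p' Hp'; apply uprod_holds; auto. }
  apply (filter_mono (UL_filter T) _ _ H); intros i Hi; apply Hw; auto.
Qed.


(** * Compactness for generalized dependencies *)

Lemma eval_conj (M : structure sg) (v : nat -> dom M) (l : list (atom sg)) :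
  eval M v (conj l) <-> forall a, In a l -> eval M v (atom_formula a).
Proof.
induction l as [|a l IH]; simpl; [tauto|].
fold (conj l); rewrite IH; split.
- intros [H1 H2] b [<-|]; auto.
- intros H; split; [|intros]; apply H; auto.
Qed.

Lemma eval_disj (M : structure sg) (v : nat -> dom M) (l : list (formula sg)) :
  eval M v (disj l) <-> exists f, In f l /\ eval M v f.
Proof.
induction l as [|f l IH]; simpl.
- split; [tauto|intros [f [[] _]]].
- fold (disj l); rewrite IH; split.
  + intros [H|[g [H1 H2]]]; eauto.
  + intros [g [[->|H1] H2]]; eauto.
Qed.

Lemma eval_foralls (M : structure sg) (xs : list nat) (f : formula sg) :
  forall v : nat -> dom M, eval M v (foralls xs f) <->
  forall v' : nat -> dom M, (forall x, ~ In x xs -> v' x = v x) -> eval M v' f.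
Proof.
induction xs as [|x xs IH]; intros v; simpl.
- split; intros H; [intros v' H'|apply H; auto].
  apply (eval_ext M f v' v); auto.
- fold (foralls xs f); split.
  + intros H v' H'; specialize (H (v' x)); apply (proj1 (IH _)) with (v' := v') in H; auto.
    intros y Hy; unfold upd; destruct (Nat.eqb_spec y x); [congruence|].
    apply H'; intros [|]; auto.
  + intros H a; apply IH; intros v' H'; apply H; intros y Hy.
    rewrite H' by tauto; unfold upd; destruct (Nat.eqb_spec y x); auto.
    destruct Hy; auto.
Qed.

Lemma eval_existss (M : structure sg) (xs : list nat) (f : formula sg) :
  forall v : nat -> dom M, eval M v (existss xs f) <->
  exists v' : nat -> dom M, (forall x, ~ In x xs -> v' x = v x) /\ eval M v' f.
Proof.
induction xs as [|x xs IH]; intros v; simpl.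
- split; [intros H; exists v; auto|intros [v' [H' H]]].
  apply (eval_ext M f v' v); auto.
- fold (existss xs f); split.
  + intros [a Ha]; apply IH in Ha; destruct Ha as [v' [H1 H2]]; exists v'; split; auto.
    intros y Hy; rewrite H1 by tauto; unfold upd; destruct (Nat.eqb_spec y x); auto.
    destruct Hy; auto.
  + intros [v' [H1 H2]]; exists (v' x); apply IH; exists v'; split; auto.
    intros y Hy; unfold upd; destruct (Nat.eqb_spec y x); [congruence|].
    apply H1; intros [|]; auto.
Qed.

Lemma free_conj (x : nat) (l : list (atom sg)) :
  free_in x (conj l) -> exists a, In a l /\ free_in x (atom_formula a).
Proof.
induction l as [|a l IH]; simpl; [tauto|]; fold (conj l).
intros [H|H]; [eauto|destruct (IH H) as [b [? ?]]; eauto].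
Qed.

Lemma free_disj (x : nat) (l : list (formula sg)) :
  free_in x (disj l) <-> exists f, In f l /\ free_in x f.
Proof.
induction l as [|f l IH]; simpl.
- split; [tauto|intros [f [[] _]]].
- fold (disj l); rewrite IH; split.
  + intros [H|[g [H1 H2]]]; eauto.
  + intros [g [[->|H1] H2]]; eauto.
Qed.

Lemma free_foralls (x : nat) (xs : list nat) (f : formula sg) :
  free_in x (foralls xs f) <-> ~ In x xs /\ free_in x f.
Proof. induction xs; simpl; [tauto|]; fold (foralls xs f); tauto. Qed.

Lemma free_existss (x : nat) (xs : list nat) (f : formula sg) :
  free_in x (existss xs f) <-> ~ In x xs /\ free_in x f.
Proof. induction xs; simpl; [tauto|]; fold (existss xs f); tauto. Qed.

Lemma eval_gd (M : structure sg) (v : nat -> dom M) (g : gd sg) :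
  eval M v (gd_formula g) <->
  forall v' : nat -> dom M, (forall x, ~ In x (gd_x g) -> v' x = v x) ->
  (forall a, In a (gd_body g) -> eval M v' (atom_formula a)) ->
  exists (u : nat -> dom M) (l : list (atom sg)),
    (forall y, ~ In y (gd_y g) -> u y = v' y) /\ In l (gd_heads g) /\
    forall a, In a l -> eval M u (atom_formula a).
Proof.
unfold gd_formula; rewrite eval_foralls; simpl.
split; intros H v' Hv' Hb.
- specialize (H v' Hv'); rewrite eval_conj, eval_existss in H.
  destruct (H Hb) as [u [Hu Hd]]; apply eval_disj in Hd; destruct Hd as [f [Hf Hd]].
  apply in_map_iff in Hf; destruct Hf as [l [<- Hl]].
  exists u, l; split; [auto|split; [auto|]]; apply eval_conj; auto.
- rewrite eval_conj in Hb; destruct (H v' Hv' Hb) as [u [l [Hu [Hl Ha]]]].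
  apply eval_existss; exists u; split; auto; apply eval_disj; exists (conj l); split.
  + apply in_map; auto.
  + apply eval_conj; auto.
Qed.

Definition tterm (X : Type) (g : X -> nat) (t : X + sconst sg) : term sg :=
  match t with inl x => TVar (g x) | inr c => TCst c end.

Definition to_atom (X : Type) (g : X -> nat) (p : patom X) : atom sg :=
  match p with
  | PEq t1 t2 => AEq (tterm g t1) (tterm g t2)
  | PRel r ts => ARel r (fun k => tterm g (ts k))
  end.

Lemma eval_to_atom (M : structure sg) (X : Type) (g : X -> nat) (p : patom X)
    (v : nat -> dom M) :
  eval M v (atom_formula (to_atom g p)) <-> holds M (fun x => v (g x)) p.
Proof.
assert (E : forall t, teval M v (tterm g t) = pterm M (fun x => v (g x)) t)
  by (intros []; auto).
destruct p; simpl; [rewrite !E; tauto|].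
replace (fun k => pterm M (fun x => v (g x)) (ts k))
  with (fun k => teval M v (tterm g (ts k))); [tauto|].
extensionality k; auto.
Qed.

Lemma free_to_atom (X : Type) (g : X -> nat) (p : patom X) (n : nat) :
  free_in n (atom_formula (to_atom g p)) -> exists x, In x (pvars p) /\ n = g x.
Proof.
assert (E : forall t, term_free n (tterm g t) -> exists x, In x (tvars t) /\ n = g x).
{ intros [x|c]; simpl; [|tauto]; intros <-; eauto. }
destruct p; simpl.
- intros [H|H]; apply E in H; destruct H as [x [H1 H2]]; exists x; split; auto;
    apply in_or_app; auto.
- intros [k H]; apply E in H; destruct H as [x [H1 H2]]; exists x; split; auto.
  apply in_flat_map; exists k; split; auto; apply in_idx_list.
Qed.

(** Used to replace the finitely many elements that occur in a set of facts by variables numbered in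
    [nat]. *)
Lemma finite_numbering (X : Type) (d : X) (l : list X) :
  exists (num : X -> nat) (val : nat -> X), forall x, In x l -> val (num x) = x.
Proof.
assert (H : forall x, exists n, In x l -> nth n l d = x).
{ intros x; destruct (classic (In x l)) as [H|H].
  - destruct (In_nth l x d H) as [n [_ Hn]]; eauto.
  - exists 0; tauto. }
apply choice in H; destruct H as [num Hnum].
exists num, (fun n => nth n l d); auto.
Qed.

Lemma list_comprehension (X : Type) (P : X -> Prop) (l : list X) :
  exists l', forall x, In x l' <-> In x l /\ P x.
Proof.
induction l as [|x l [l' H]].
- exists []; simpl; tauto.
- destruct (classic (P x)) as [Hx|Hx]; [exists (x :: l')|exists l'];
    intros y; simpl; rewrite H; split; intros Hy; intuition (subst; tauto).
Qed.

(** Left variables are parameters, right ones are existentially quantified: a list of atoms over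
    such variables is a primitive positive formula with parameters. *)
Definition join (X Y Z : Type) (w : X -> Z) (u : Y -> Z) (t : X + Y) : Z :=
  match t with inl x => w x | inr y => u y end.

Definition gd_consequence (phi : formula sg) (g : gd sg) : Prop :=
  is_gd_sentence g /\ forall M, models M phi -> models M (gd_formula g).

(* The positive facts [P] and the refuted existential facts [N] form the body and
   the heads of a dependency that fails in [A]. *)
Lemma diagram_consistent (phi : formula sg) (A : structure sg)
    (P : list (patom (dom A))) (N : list (list (patom (dom A + nat)))) :
  (forall g, gd_consequence phi g -> models A (gd_formula g)) ->
  (forall p, In p P -> holds A (fun a => a) p) ->
  (forall l, In l N ->
     ~ exists u : nat -> dom A, forall p, In p l -> holds A (join (fun a => a) u) p) ->
  exists (M : structure sg) (w : dom A -> dom M), models M phi /\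
    (forall p, In p P -> holds M w p) /\
    (forall l, In l N ->
       ~ exists u : nat -> dom M, forall p, In p l -> holds M (join w u) p).
Proof.
intros HA HP HN; apply NNPP; intros Hno.
set (V := map inl (flat_map (@pvars _) P) ++ flat_map (flat_map (@pvars _)) N).
set (es := flat_map (fun t : dom A + nat => match t with inl a => [a] | inr _ => [] end) V).
set (os := flat_map (fun t : dom A + nat => match t with inl _ => [] | inr y => [y] end) V).
destruct (finite_numbering (dom_elt A) es) as [num [val Hval]].
(* Parameters become even variables and existential variables odd ones, which keeps the two
   quantifier blocks disjoint. *)
set (g := fun t : dom A + nat => match t with inl a => 2 * num a | inr y => S (2 * y) end).
assert (HVl : forall a, In (inl a) V -> In a es)
  by (intros a Ha; apply in_flat_map; exists (inl a); simpl; auto).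
assert (HVr : forall y, In (inr y) V -> In y os)
  by (intros y Hy; apply in_flat_map; exists (inr y); simpl; auto).
assert (HPV : forall p a, In p P -> In a (pvars p) -> In (inl a) V).
{ intros p a Hp Ha; apply in_or_app; left; apply in_map, in_flat_map; eauto. }
assert (HNV : forall l p t, In l N -> In p l -> In t (pvars p) -> In t V).
{ intros l p t Hl Hp Ht; apply in_or_app; right.
  apply in_flat_map; exists l; split; auto; apply in_flat_map; eauto. }
set (xs := map (fun a => 2 * num a) es).
set (ys := map (fun y => S (2 * y)) os).
assert (Hys : forall a, ~ In (2 * num a) ys).
{ intros a Ha; apply in_map_iff in Ha; destruct Ha as [y [Hy _]]; lia. }
set (G := GD xs (map (to_atom (fun a => g (inl a))) P) ys (map (map (to_atom g)) N)).
assert (HG : gd_consequence phi G).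
{ split.
  - intros n Hn; unfold gd_formula in Hn; apply free_foralls in Hn; destruct Hn as [H1 H2].
    simpl in H1, H2; destruct H2 as [H2|H2].
    + apply free_conj in H2; destruct H2 as [a [Ha H2]].
      apply in_map_iff in Ha; destruct Ha as [p [<- Hp]].
      apply free_to_atom in H2; destruct H2 as [a [Ha ->]].
      apply H1; apply (in_map (fun a => 2 * num a)); eauto.
    + apply free_existss in H2; destruct H2 as [H2 H3].
      apply free_disj in H3; destruct H3 as [f [Hf H3]].
      apply in_map_iff in Hf; destruct Hf as [l [<- Hl]].
      apply in_map_iff in Hl; destruct Hl as [l' [<- Hl]].
      apply free_conj in H3; destruct H3 as [a [Ha H3]].
      apply in_map_iff in Ha; destruct Ha as [p [<- Hp]].
      apply free_to_atom in H3; destruct H3 as [[a|y] [Ha ->]].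
      * apply H1; apply (in_map (fun a => 2 * num a)); eauto.
      * apply H2; apply (in_map (fun y => S (2 * y))); eauto.
  - intros M HM v0; apply eval_gd; simpl; intros v _ Hb.
    (* If every head failed at [v], then [M] with this reading of the parameters would be the model
       that [Hno] excludes. *)
    apply NNPP; intros Hh; apply Hno; exists M, (fun a => v (2 * num a)).
    split; [auto|split].
    + intros p Hp; apply (eval_to_atom M (fun a => g (inl a)) p v), Hb, in_map; auto.
    + intros l Hl [u Hu]; apply Hh.
      exists (fun n => if in_dec Nat.eq_dec n ys then u (Nat.div2 n) else v n),
             (map (to_atom g) l).
      split; [intros y Hy; destruct in_dec; tauto|split; [apply in_map; auto|]].
      intros a Ha; apply in_map_iff in Ha; destruct Ha as [p [<- Hp]].
      apply eval_to_atom; refine (proj1 (holds_ext M _ _ p _) (Hu p Hp)).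
      intros [a|y] Hay; simpl join; unfold g.
      * destruct in_dec as [Hi|_]; auto; destruct (Hys a Hi).
      * destruct in_dec as [Hi|Hi].
        -- rewrite Nat.div2_succ_double; auto.
        -- destruct Hi; apply (in_map (fun y => S (2 * y))); eauto. }
(* So [G] holds in [A]. At the valuation decoding each even variable to its element the body is true
   by [HP], and the head that follows contradicts [HN]. *)
pose proof (HA G HG (fun n => val (Nat.div2 n))) as H.
rewrite eval_gd in H; destruct (H _ (fun _ _ => eq_refl)) as [u [l [Hu [Hl Hh]]]].
- intros a Ha; unfold G in Ha; cbn [gd_body] in Ha; apply in_map_iff in Ha; destruct Ha as [p [<- Hp]].
  apply eval_to_atom; refine (proj1 (holds_ext A _ _ p _) (HP p Hp)).
  intros a Ha; unfold g; rewrite Nat.div2_double; symmetry; eauto.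
- unfold G in Hu, Hl; cbn [gd_y gd_heads] in Hu, Hl.
  apply in_map_iff in Hl; destruct Hl as [l' [<- Hl]]; apply (HN l' Hl).
  exists (fun y => u (S (2 * y))); intros p Hp.
  assert (Hp' := Hh _ (in_map (to_atom g) _ _ Hp)); apply eval_to_atom in Hp'.
  refine (proj1 (holds_ext A _ _ p _) Hp').
  intros [a|y] Hay; simpl join; unfold g; auto.
  rewrite Hu by apply Hys; rewrite Nat.div2_double; eauto.
Qed.

(** A requirement is an atom true in [A], to be preserved, or a primitive positive fact refuted in
    [A], to stay refuted. Each finite list of requirements has a model of [phi] by
    [diagram_consistent]; the ultraproduct of these models meets all of them. *)
Lemma immersion_into_model (phi : formula sg) (A : structure sg) :
  (forall g, gd_consequence phi g -> models A (gd_formula g)) ->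
  exists (B : structure sg) (f : dom A -> dom B), models B phi /\ immersion A B f.
Proof.
intros HA.
set (T := (patom (dom A) + list (patom (dom A + nat)))%type).
set (neg := fun (M : structure sg) (w : dom A -> dom M) (l : list (patom (dom A + nat))) =>
  ~ exists u : nat -> dom M, forall p, In p l -> holds M (join w u) p).
assert (H : forall i : list T, exists Mw : {M : structure sg & dom A -> dom M},
   models (projT1 Mw) phi /\
   (forall p, In (inl p) i -> holds A (fun a => a) p -> holds (projT1 Mw) (projT2 Mw) p) /\
   (forall l, In (inr l) i -> neg A (fun a => a) l -> neg (projT1 Mw) (projT2 Mw) l)).
{ intros i.
  destruct (list_comprehension (holds A (fun a => a))
    (flat_map (fun t : T => match t with inl p => [p] | inr _ => [] end) i)) as [P HP].
  destruct (list_comprehension (neg A (fun a => a))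
    (flat_map (fun t : T => match t with inl _ => [] | inr l => [l] end) i)) as [N HN].
  destruct (diagram_consistent P N HA) as [M [w [H1 [H2 H3]]]].
  - intros p Hp; apply HP; auto.
  - intros l Hl; apply HN; auto.
  - exists (existT _ M w); simpl; split; [auto|split].
    + intros p Hp Hp'; apply H2, HP; split; auto.
      apply in_flat_map; exists (inl p); simpl; auto.
    + intros l Hl Hl'; apply H3, HN; split; auto.
      apply in_flat_map; exists (inr l); simpl; auto. }
apply choice in H; destruct H as [Mw HMw].
set (M := fun i => projT1 (Mw i)).
set (w := fun i => projT2 (Mw i) : dom A -> dom (M i)).
set (f := fun a => ucls M (fun i => w i a)).
assert (Hneg : forall l, neg A (fun a => a) l -> neg (uprod M) f l).
{ intros l Hl [u Hu].
  assert (H : UL T (fun i => forall p, In p l ->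
                   holds (M i) (fun t => rep (join f u t) i) p)).
  { apply (filter_Forall (UL_filter T)); intros p Hp; apply uprod_holds; auto. }
  assert (H' : UL T (fun i => forall p, In p l ->
                   holds (M i) (join (w i) (fun y => rep (u y) i)) p)).
  { apply (filter_Forall (UL_filter T)); intros p Hp.
    specialize (Hu p Hp); apply uprod_holds in Hu.
    refine (proj1 (filter_holds_ext M p (fun i t => rep (join f u t) i)
      (fun i => join (w i) (fun y => rep (u y) i)) (UL_filter T) _) Hu).
    intros [a|y]; simpl join; [apply (rep_ucls M (fun i => w i a))|].
    apply (filter_all (UL_filter T)); auto. }
  destruct (filter_ex (UL_filter T) _ (filter_and (UL_filter T) _ _ H' (UL_in (inr l : T))))
    as [i [Hi1 Hi2]].
  destruct (HMw i) as [_ [_ HM]]; apply (HM l Hi2 Hl).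
  exists (fun y => rep (u y) i); exact Hi1. }
assert (inj : forall a b, f a = f b -> a = b).
{ intros a b E; apply NNPP; intros Hab.
  apply (Hneg [PEq (inl (inl a)) (inl (inl b))]).
  - intros [u Hu]; apply Hab; exact (Hu _ (or_introl eq_refl)).
  - exists (fun _ => f a); intros p [<-|[]]; exact E. }
exists (uprod M), f; split; [|split].
- intros v; apply uprod_los; apply (filter_all (UL_filter T)); intros i; apply HMw.
- apply hom_of_facts; intros p Hp; apply (uprod_holds_ucls M p w).
  apply (filter_mono (UL_filter T) _ _ (UL_in (inl p : T))).
  intros i Hi; apply (HMw i); auto.
- intros l Hl.
  destruct (finite_numbering (f (dom_elt A)) (flat_map (@pvars _) l)) as [num [val Hval]].
  (* Elements in the image of [f] are read as parameters, which injectivity makes unambiguous; the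
     other elements occurring in [l] become existential variables. *)
  assert (S : forall d, exists t : dom A + nat,
    (forall a, d = f a -> t = inl a) /\
    (In d (flat_map (@pvars _) l) -> join f val t = d)).
  { intros d; destruct (classic (exists a, d = f a)) as [[a ->]|Hd].
    - exists (inl a); split; auto; intros b E; f_equal; auto.
    - exists (inr (num d)); split; [intros a ->; destruct Hd; eauto|exact (Hval d)]. }
  apply choice in S; destruct S as [s Hs].
  (* Read this way, [l] is a primitive positive fact true in the ultraproduct, so by [Hneg] it is
     not refuted in [A]; its witnesses there define the retraction. *)
  assert (Hu : exists u : nat -> dom A, forall p, In p (map (pmap s) l) ->
                 holds A (join (fun a => a) u) p).
  { apply NNPP; intros N; apply (Hneg _ N); exists val; intros p Hp.
    apply in_map_iff in Hp; destruct Hp as [p' [<- Hp]]; apply holds_pmap.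
    refine (proj1 (holds_ext (uprod M) _ _ p' _) (Hl p' Hp)).
    intros d Hd; symmetry; apply Hs, in_flat_map; eauto. }
  destruct Hu as [u Hu]; exists (fun d => join (fun a => a) u (s d)); split.
  + intros a; rewrite (proj1 (Hs (f a)) a eq_refl); auto.
  + intros p Hp; apply (holds_pmap A s (join (fun a => a) u) p), Hu, in_map; auto.
Qed.

(** Otherwise every finite list of dependencies has a model of its members in [S] that refutes
    [phi]. The ultraproduct of these models satisfies all of [S], hence [phi], and then so does some
    factor. *)
Lemma finite_axiomatization (phi : formula sg) (S : gd sg -> Prop) :
  sentence phi ->
  (forall A, (forall g, S g -> models A (gd_formula g)) -> models A phi) ->
  exists L : list (gd sg), (forall g, In g L -> S g) /\
    forall A, (forall g, In g L -> models A (gd_formula g)) -> models A phi.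
Proof.
intros Hphi HS; apply NNPP; intros Hno.
assert (H : forall L : list (gd sg), exists A,
   (forall g, In g L -> S g -> models A (gd_formula g)) /\ ~ models A phi).
{ intros L; apply NNPP; intros HL; apply Hno.
  destruct (list_comprehension S L) as [L' HL']; exists L'; split.
  - intros g Hg; apply HL'; auto.
  - intros A HA; apply NNPP; intros HAphi; apply HL; exists A; split; auto.
    intros g Hg HgS; apply HA, HL'; auto. }
apply choice in H; destruct H as [M HM].
assert (HU : models (uprod M) phi).
{ apply HS; intros g Hg v; apply uprod_los.
  apply (filter_mono (UL_filter _) _ _ (UL_in g)).
  intros L HL; apply (HM L); auto. }
specialize (HU (fun _ => dom_elt (uprod M))); apply uprod_los in HU.
destruct (filter_ex (UL_filter _) _ HU) as [L HL].
destruct (HM L) as [_ HL']; apply HL'; intros v.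
refine (proj1 (sentence_eval (M L) _ v Hphi) HL).
Qed.


(** * Limits of elementary chains *)

(** Dependent choice started at stage [N]; the defaults [d] fill the stages before it. *)
Lemma dependent_chain (N : nat) : forall (X : nat -> Type) (d : forall n, X n)
    (Q : forall n, X n -> X (S n) -> Prop),
  (forall n x, exists y, Q n x y) -> forall a : X N,
  exists x : forall n, X n, x N = a /\ forall n, N <= n -> Q n (x n) (x (S n)).
Proof.
induction N as [|N IH]; intros X d Q HQ a.
- exists (nat_rect X a (fun n x =>
    proj1_sig (constructive_indefinite_description _ (HQ n x)))).
  split; auto; intros n _; simpl.
  destruct (constructive_indefinite_description _ _); auto.
- destruct (IH (fun n => X (S n)) (fun n => d (S n)) (fun n => Q (S n))
              (fun n => HQ (S n)) a) as [x [Hx1 Hx2]].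
  exists (fun n => match n with 0 => d 0 | S m => x m end); split; auto.
  intros [|n] Hn; [lia|]; apply Hx2; lia.
Qed.

Definition eventually (P : nat -> Prop) : Prop := exists N, forall n, N <= n -> P n.

Lemma eventually_filter : is_filter eventually.
Proof.
constructor.
- intros P H; exists 0; auto.
- intros P Q [m Hm] [n Hn]; exists (m + n); intros k Hk; split; [apply Hm|apply Hn]; lia.
- intros P Q [m Hm] H; exists m; auto.
- intros P [m Hm]; exists m; auto.
Qed.

Record chain := Chain {
  cM : nat -> structure sg;
  ce : forall n, dom (cM n) -> dom (cM (S n));
  c_elem : forall n (f : formula sg) (v : nat -> dom (cM n)),
    eval (cM n) v f <-> eval (cM (S n)) (fun x => ce n (v x)) f
}.

Section ChainLimit.
Variable C : chain.

Definition coherent (x : forall n, dom (cM C n)) : Prop :=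
  eventually (fun n => x (S n) = ce C n (x n)).

Definition base_thread (n : nat) : dom (cM C n) :=
  nat_rect (fun n => dom (cM C n)) (dom_elt (cM C 0)) (ce C) n.

Lemma base_thread_coherent : coherent base_thread.
Proof. exists 0; auto. Qed.

Lemma cst_coherent (c : sconst sg) : coherent (fun n => cst (cM C n) c).
Proof.
exists 0; intros n _; symmetry.
apply (c_elem C n (FEq (TVar 0) (TCst c)) (fun _ => cst (cM C n) c)); reflexivity.
Qed.

Definition lim_data : redprod := {|
  r_filter := eventually_filter;
  rX := coherent;
  r_eltX := base_thread_coherent;
  r_cstX := cst_coherent
|}.

Definition lim : structure sg := Red lim_data.

(** The filter [eventually] is not an ultrafilter, yet it decides formulas at coherent families:
    once all threads at free variables follow the chain, elementarity freezes the truth value. *)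
Lemma coherent_eval (f : formula sg) (v : nat -> forall n, dom (cM C n)) :
  (forall x, coherent (v x)) ->
  exists N, forall n, N <= n ->
    (eval (cM C n) (fun x => v x n) f <-> eval (cM C N) (fun x => v x N) f).
Proof.
intros Hv; destruct (filter_free f _ eventually_filter Hv) as [N HN].
exists N; intros n Hn; induction Hn as [|n Hn IH]; [tauto|].
rewrite <- IH, (c_elem C n f); apply eval_ext; auto.
Qed.

Lemma lim_los (f : formula sg) (v : nat -> dom lim) :
  eval lim v f <-> eventually (fun n => eval (cM C n) (fun x => rep (v x) n) f).
Proof.
apply (@los lim_data); simpl; clear f v.
- intros f v Hv; destruct (coherent_eval f v Hv) as [N HN].
  destruct (classic (eval (cM C N) (fun x => v x N) f)) as [H|H]; [left|right];
    exists N; intros n Hn; rewrite (HN n Hn); auto.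
- intros f x v Hv [N1 H1].
  destruct (filter_free f _ eventually_filter Hv) as [N2 H2].
  set (N := N1 + N2); destruct (H1 N) as [a Ha]; [lia|].
  (* The witness found at stage [N] is pushed along the chain; it remains a witness by
     elementarity. *)
  destruct (dependent_chain N (fun n => dom (cM C n)) base_thread
    (fun n b c => c = ce C n b) (fun n b => ex_intro _ _ eq_refl) a) as [y [Hy1 Hy2]].
  exists y; split; [exists N; exact Hy2|].
  exists N; intros n Hn; induction Hn as [|n Hn IH]; [rewrite Hy1; auto|].
  apply (c_elem C n f) in IH; refine (proj1 (eval_ext _ _ _ _ _) IH).
  intros z Hz; unfold upd; destruct (Nat.eqb_spec z x); symmetry; [apply Hy2; auto|].
  apply H2; auto; lia.
Qed.

Lemma lim_models (f : formula sg) : sentence f -> (models lim f <-> models (cM C 0) f).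
Proof.
intros Hf.
assert (H : forall n, models (cM C n) f <-> models (cM C 0) f).
{ induction n as [|n IH]; [tauto|]; rewrite <- IH; split; intros H v.
  - apply c_elem; auto.
  - refine (proj1 (sentence_eval _ _ v Hf) (proj1 (c_elem C n f (fun _ => base_thread n)) (H _))). }
split; intros Hm.
- specialize (Hm (fun _ => dom_elt lim)); apply lim_los in Hm; destruct Hm as [N HN].
  apply (H N); intros v; exact (proj1 (sentence_eval _ _ v Hf) (HN N (le_n N))).
- intros v; apply lim_los; exists 0; intros n _; apply H; auto.
Qed.

End ChainLimit.

Lemma lim_map (C D : chain) (f : forall n, dom (cM C n) -> dom (cM D n)) :
  (forall n, hom (cM C n) (cM D n) (f n)) ->
  (forall n a, f (S n) (ce C n a) = ce D n (f n a)) ->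
  exists F, hom (lim C) (lim D) F /\
    forall q, eventually (fun n => rep (F q) n = f n (rep q n)).
Proof.
intros Hf Hc.
assert (GX : forall x, coherent C x -> coherent D (fun n => f n (x n))).
{ intros x [N HN]; exists N; intros n Hn; rewrite HN; auto. }
exists (fun q : dom (lim C) => @cls (lim_data D) (fun n => f n (rep q n)) (GX _ (repX q))); split.
- apply (@red_hom (lim_data C) (lim_data D) (fun x n => f n (x n)) GX).
  intros p [N HN]; exists N; intros n Hn; apply (@holds_hom _ _ (f n)); auto.
  apply HN; auto.
- intros q; apply (rep_cls (lim_data D)).
Qed.

Lemma lim_shift_map (C D : chain) (N : nat) (g : forall n, dom (cM C n) -> dom (cM D (S n))) :
  (forall n, N <= n -> hom (cM C n) (cM D (S n)) (g n)) ->
  (forall n a, N <= n -> g (S n) (ce C n a) = ce D (S n) (g n a)) ->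
  exists G, hom (lim C) (lim D) G /\
    forall q, eventually (fun n => rep (G q) (S n) = g n (rep q n)).
Proof.
intros Hg Hc.
(* The value at stage 0 is a default, and the maps [g n] with [n < N] may be arbitrary: the limit
   sees late stages only. *)
set (G := fun (x : forall n, dom (cM C n)) (n : nat) =>
  match n return dom (cM D n) with 0 => dom_elt _ | S m => g m (x m) end).
assert (GX : forall x, coherent C x -> coherent D (G x)).
{ intros x [N' HN]; exists (S (N + N')); intros [|n] Hn; [lia|]; simpl.
  rewrite HN, Hc by lia; auto. }
exists (fun q : dom (lim C) => @cls (lim_data D) (G (rep q)) (GX _ (repX q))); split.
- apply (@red_hom (lim_data C) (lim_data D) G GX).
  intros p [N' HN]; exists (S (N + N')); intros [|n] Hn; [lia|]; simpl.
  apply (@holds_hom _ _ (g n)); [apply Hg; lia|]; apply HN; lia.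
- intros q; destruct (rep_cls (lim_data D) (G (rep q)) (GX _ (repX q))) as [m Hm].
  exists m; intros n Hn; apply (Hm (S n)); lia.
Qed.

(** * The tower of ultrapowers *)

Record stage := Stage {
  sA : structure sg;
  sB : structure sg;
  sf : dom sA -> dom sB;
  s_imm : immersion sA sB sf
}.

(** This is the exponent of [hom_extension] for an immersion into [sB s], so homomorphisms into
    [sA s] extend along it with values in the next [sA]. *)
Definition next (s : stage) : stage :=
  Stage (umap_immersion (patom (dom (sB s))) (s_imm s)).

Section Tower.
Variable s0 : stage.

Fixpoint tower (n : nat) : stage := match n with 0 => s0 | S m => next (tower m) end.

Definition chainA : chain := Chain (fun n => sA (tower n))
  (fun n => diag (patom (dom (sB (tower n)))) (sA (tower n)))
  (fun n => @diag_eval (patom (dom (sB (tower n)))) (sA (tower n))).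

Definition chainB : chain := Chain (fun n => sB (tower n))
  (fun n => diag (patom (dom (sB (tower n)))) (sB (tower n)))
  (fun n => @diag_eval (patom (dom (sB (tower n)))) (sB (tower n))).

(** Start by extending the identity of the [N]-th [sA] along the immersion [sf (tower N)]; then
    extend each [g n] along the diagonal into the next [sB]. *)
Lemma backward_homs (N : nat) :
  exists g : forall n, dom (cM chainB n) -> dom (cM chainA (S n)),
    (forall n, N <= n -> hom (cM chainB n) (cM chainA (S n)) (g n)) /\
    (forall n b, N <= n -> g (S n) (ce chainB n b) = ce chainA (S n) (g n b)) /\
    (forall a, g N (sf (tower N) a) = ce chainA N a).
Proof.
assert (hom_id : forall A : structure sg, hom A A (fun a => a)).
{ intros A; split; auto. }
destruct (hom_extension (s_imm (tower N)) (hom_id (sA (tower N)))) as [gN [HgN1 HgN2]].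
set (H := fun n => hom (cM chainB n) (cM chainA (S n))).
destruct (dependent_chain N
  (fun n => dom (cM chainB n) -> dom (cM chainA (S n)))
  (fun n _ => dom_elt (cM chainA (S n)))
  (* [dependent_chain] wants a successor for every map, so being a homomorphism is a premise here;
     it is recovered by induction in [Hh]. *)
  (fun n g g' => H n g ->
     H (S n) g' /\ forall b, g' (ce chainB n b) = ce chainA (S n) (g b))) with (a := gN)
  as [g [Hg1 Hg2]].
- intros n g; destruct (classic (H n g)) as [Hg|Hg].
  + destruct (hom_extension
      (diag_immersion (patom (dom (sB (tower n)))) (sB (tower n))) Hg) as [g' [H1 H2]].
    exists g'; split; auto.
  + exists (fun _ => dom_elt _); tauto.
- assert (Hh : forall n, N <= n -> H n (g n)).
  { intros n Hn; induction Hn as [|n Hn IH]; [rewrite Hg1; auto|]; apply Hg2; auto. }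
  exists g; split; [auto|split].
  + intros n b Hn; apply Hg2; auto.
  + intros a; rewrite Hg1; apply HgN2.
Qed.

(** One forward map [F] serves all tuples. A tuple only determines a stage [N] from which its
    threads are coherent, and the backward homomorphisms started at [N] return it. *)
Lemma tower_glob_hom : glob_hom (lim chainA) (lim chainB).
Proof.
destruct (@lim_map chainA chainB (fun n => sf (tower n))) as [F [HF1 HF2]].
{ intros n; apply (s_imm (tower n)). }
{ intros n a; apply umap_diag. }
exists (map F); intros l; split; [apply length_map|]; split; [exists F; auto|].
destruct (filter_Forall eventually_filter l
  (fun q n => rep q (S n) = ce chainA n (rep q n)) (fun q _ => repX q)) as [N HN].
destruct (backward_homs N) as [g [Hg1 [Hg2 Hg3]]].
destruct (lim_shift_map chainB chainA g Hg1 Hg2) as [G [HG1 HG2]].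
exists G; split; auto; rewrite map_map; rewrite <- (map_id l) at 2.
apply map_ext_in; intros q Hq.
(* True at [N] by the choice of [g N], and passed on because the thread follows the diagonals, with
   which both [sf] and [g] commute. *)
assert (Hgf : forall n, N <= n -> g n (sf (tower n) (rep q n)) = ce chainA n (rep q n)).
{ intros n Hn; induction Hn as [|n Hn IH]; [apply Hg3|].
  rewrite (HN n Hn q Hq).
  transitivity (g (S n) (ce chainB n (sf (tower n) (rep q n)))).
  - f_equal; apply umap_diag.
  - rewrite Hg2, IH; auto. }
apply rep_inj; destruct (HF2 q) as [m1 H1], (HG2 (F q)) as [m2 H2].
(* [G] is described at successor stages only. At [S n] its value on [F q] is the diagonal image of
   [rep q n], which is [rep q (S n)] by coherence. *)
exists (S (N + m1 + m2)); intros [|n] Hn; [lia|].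
rewrite H2, H1, Hgf by lia; symmetry; apply HN; auto; lia.
Qed.

End Tower.

(** * Preservation of generalized dependencies *)

Lemma gd_glob_hom (A B : structure sg) (g : gd sg) :
  is_gd_sentence g -> glob_hom A B -> models B (gd_formula g) -> models A (gd_formula g).
Proof.
assert (atom_hom : forall (C D : structure sg) h, hom C D h -> forall (a : atom sg) v,
  eval C v (atom_formula a) -> eval D (fun x => h (v x)) (atom_formula a)).
{ intros C D h [Hc Hr].
  assert (E : forall v t, h (teval C v t) = teval D (fun x => h (v x)) t)
    by (intros v []; simpl; auto).
  intros [t1 t2|r ts] v; simpl; intros H.
  - rewrite <- !E; congruence.
  - apply Hr in H; replace (fun i => teval D (fun x => h (v x)) (ts i))
      with (fun i => h (teval C v (ts i))); auto.
    extensionality i; auto. }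
intros Hg [pi Hpi] HB v0; apply eval_gd; intros v _ Hb.
destruct (Hpi (map v (gd_x g))) as [_ [[h [Hh1 Hh2]] [k [Hk1 Hk2]]]].
rewrite <- Hh2, map_map, map_map in Hk2.
assert (Hk : forall x, In x (gd_x g) -> k (h (v x)) = v x).
{ apply ext_in_map; auto. }
specialize (HB (fun x => h (v x))); rewrite eval_gd in HB.
destruct (HB _ (fun _ _ => eq_refl)) as [u [l [Hu1 [Hu2 Hu3]]]].
{ intros a Ha; apply (atom_hom _ _ h); auto. }
exists (fun x => if in_dec Nat.eq_dec x (gd_y g) then k (u x) else v x), l.
split; [intros y Hy; destruct in_dec; tauto|split; auto].
intros a Ha; refine (proj1 (eval_ext _ _ _ _ _) (atom_hom _ _ k Hk1 a u (Hu3 a Ha))).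
intros x Hx; destruct in_dec as [Hy|Hy]; auto.
(* A variable of the head outside [gd_y] must lie in [gd_x], since otherwise it would be free in the
   sentence; there [k] undoes [h]. *)
rewrite Hu1 by auto; apply Hk, NNPP; intros Hn; apply (Hg x).
apply free_foralls; split; auto; simpl; right; apply free_existss; split; auto.
apply free_disj; exists (conj l); split; [apply in_map; auto|].
clear - Ha Hx; induction l as [|b l IH]; [destruct Ha|destruct Ha as [->|Ha]; simpl; auto].
Qed.

End Logic.

Theorem theorem1 (sg : signature) (phi : formula sg) :
  sentence phi ->
  ((exists Sigma : list (gd sg),
      (forall g, In g Sigma -> is_gd_sentence g) /\
      (forall M : structure sg,
         models M phi <-> (forall g, In g Sigma -> models M (gd_formula g))))
   <->
   (forall A B : structure sg, glob_hom A B -> models B phi -> models A phi)).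
Proof.
intros Hphi; split.
- intros [Sigma [HS1 HS2]] A B HAB HB; apply HS2; intros g Hg.
  apply (gd_glob_hom (HS1 g Hg) HAB); apply (proj1 (HS2 B) HB g Hg).
- intros Hpres.
  destruct (@finite_axiomatization sg phi (gd_consequence phi) Hphi) as [L [HL1 HL2]].
  + intros A HA; destruct (immersion_into_model HA) as [B [f [HB Hf]]].
    set (s := Stage Hf).
    (* Stage 0 of the two chains is [A] and [B], so [phi] climbs from [B] to its limit, crosses by
       preservation, and descends to [A]. *)
    apply (lim_models (chainA s) Hphi).
    apply (Hpres _ _ (tower_glob_hom s)).
    apply (lim_models (chainB s) Hphi); exact HB.
  + exists L; split; [intros g Hg; apply HL1; auto|].
    intros M; split; [intros HM g Hg; apply HL1; auto|apply HL2].
Qed.
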